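(* Let $\mathfrak{g}_{\bar0}=\mathbb{C}e_0$ and $\mathfrak{g}_{\bar1}=\mathbb{C}e_1$. Every $2$-dimensional complex multiplicative $3$-Hom-Lie superalgebra of superdimension $(1|1)$ is isomorphic to precisely one of the following families. 1. $\mathfrak{g}^{1,a,b}_{1;1}$: abelian, with $\alpha(e_0)=ae_0$, $\alpha(e_1)=be_1$, $a,b\in\mathbb{C}$. 2. $\mathfrak{g}^{2,a}_{1;1}$: $[e_1,e_1,e_1]=e_1$, $\alpha(e_0)=ae_0$, $\alpha(e_1)=0$, $a\in\mathbb{C}$. 3. $\mathfrak{g}^{3}_{1;1}$: $[e_1,e_1,e_0]=e_0$, $\alpha=0$. 4. $\mathfrak{g}^{4,\tau}_{1;1}$: $[e_1,e_1,e_0]=e_0$, $[e_1,e_1,e_1]=\tau e_1$, $\alpha=0$, $\tau\in\mathbb{C}^{*}$. Moreover, $\mathfrak{g}^{4,\tau}_{1;1}\cong\mathfrak{g}^{4,\tau'}_{1;1}$ if and only if $\tau=\tau'$.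
   Context: A multiplicative $3$-Hom-Lie superalgebra $(\mathfrak{g},[\cdot,\cdot,\cdot],\alpha)$ is a $\mathbb{Z}_2$-graded space $\mathfrak{g}=\mathfrak{g}_{\bar0}\oplus\mathfrak{g}_{\bar1}$ with an even trilinear bracket ($[\mathfrak{g}_{\bar i},\mathfrak{g}_{\bar j},\mathfrak{g}_{\bar k}]\subseteq\mathfrak{g}_{\bar i+\bar j+\bar k}$) and an even (grading-preserving) linear map $\alpha$ such that: $\alpha([x,y,z])=[\alpha(x),\alpha(y),\alpha(z)]$; for homogeneous elements $[x,y,z]=-(-1)^{|x||y|}[y,x,z]$ and $[x,y,z]=-(-1)^{|y||z|}[x,z,y]$; and for homogeneous elements the super-Hom-Nambu identity $$[\alpha(x_1),\alpha(x_2),[y_1,y_2,y_3]]=\sum_{i=1}^3(-1)^{(|x_1|+|x_2|)(|y_1|+\cdots+|y_{i-1}|)}B_i,$$ where $B_1=[[x_1,x_2,y_1],\alpha(y_2),\alpha(y_3)]$, $B_2=[\alpha(y_1),[x_1,x_2,y_2],\alpha(y_3)]$, $B_3=[\alpha(y_1),\alpha(y_2),[x_1,x_2,y_3]]$. Superdimension $(1|1)$ means $\dim\mathfrak{g}_{\bar0}=\dim\mathfrak{g}_{\bar1}=1$; abelian means zero bracket. Brackets of basis elements not listed and not determined by super-skew-symmetry are zero. An isomorphism is a bijective even linear map preserving the brackets and intertwining the twisting maps $\alpha$. *)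

(* Defs.v *)
From HB Require Import structures.
From mathcomp Require Import all_boot all_order all_algebra.
From mathcomp Require Import reals complex.
Set Implicit Arguments.
Unset Strict Implicit.
Unset Printing Implicit Defensive.
Import Order.TTheory GRing.Theory Num.Theory.
Local Open Scope ring_scope.

(* Degrees in Z/2 are booleans: false is even, true is odd, and addition is
   (+).  In the exponents of the signs, degrees are coerced to nat, which is
   harmless since only the parity of the exponent matters. *)
Record superTernary (F : fieldType) := SuperTernary {
  space : vectType F;
  part : bool -> {vspace space};
  bracket : space -> space -> space -> space;
  twist : space -> space
}.

Section Structure.
Variables (F : fieldType) (g : superTernary F).

Local Notation "'[b' x , y , z ]" := (@bracket F g x y z)
  (at level 0, x, y, z at level 99).
Local Notation alpha := (@twist F g).
Local Notation "'g_' i" := (part g i) (at level 8, i at level 2).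

Definition graded : Prop :=
  directv (g_ false + g_ true)%VS /\ (g_ false + g_ true)%VS = fullv.

Definition trilinear_bracket : Prop :=
  [/\ forall y z, linear (fun x => [b x, y, z]),
      forall x z, linear (fun y => [b x, y, z])
    & forall x y, linear (fun z => [b x, y, z])].

Definition even_bracket : Prop :=
  forall (i j k : bool) (x y z : space g),
    x \in g_ i -> y \in g_ j -> z \in g_ k ->
    [b x, y, z] \in g_ (i (+) j (+) k).

Definition even_twist : Prop :=
  forall (i : bool) (x : space g), x \in g_ i -> alpha x \in g_ i.

Definition multiplicative : Prop :=
  forall x y z, alpha [b x, y, z] = [b alpha x, alpha y, alpha z].

Definition super_skew : Prop :=
  forall (i j k : bool) (x y z : space g),
    x \in g_ i -> y \in g_ j -> z \in g_ k ->
    [b x, y, z] = - ((-1) ^+ (i * j)%N *: [b y, x, z]) /\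
    [b x, y, z] = - ((-1) ^+ (j * k)%N *: [b x, z, y]).

Definition super_hom_nambu : Prop :=
  forall (p1 p2 q1 q2 q3 : bool) (x1 x2 y1 y2 y3 : space g),
    x1 \in g_ p1 -> x2 \in g_ p2 ->
    y1 \in g_ q1 -> y2 \in g_ q2 -> y3 \in g_ q3 ->
    [b alpha x1, alpha x2, [b y1, y2, y3]] =
      [b [b x1, x2, y1], alpha y2, alpha y3]
      + (-1) ^+ ((p1 + p2) * q1)%N *: [b alpha y1, [b x1, x2, y2], alpha y3]
      + (-1) ^+ ((p1 + p2) * (q1 + q2))%N *:
          [b alpha y1, alpha y2, [b x1, x2, y3]].

Record mult3HomLieSuperalgebra : Prop := Mult3HomLieSuperalgebra {
  hls_graded : graded;
  hls_trilinear : trilinear_bracket;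
  hls_even_bracket : even_bracket;
  hls_linear_twist : linear alpha;
  hls_even_twist : even_twist;
  hls_multiplicative : multiplicative;
  hls_super_skew : super_skew;
  hls_super_hom_nambu : super_hom_nambu
}.

Definition superdim : nat * nat := (\dim (g_ false), \dim (g_ true)).

End Structure.

Definition isomorphic (F : fieldType) (g h : superTernary F) : Prop :=
  exists phi : 'Hom(space g, space h),
    [/\ bijective phi,
        forall (i : bool) x, x \in part g i -> phi x \in part h i,
        forall x y z,
          phi (bracket x y z) = bracket (phi x) (phi y) (phi z)
      & forall x, phi (twist x) = twist (phi x)].

Section Families.
Variable F : fieldType.

Definition e0 : 'rV[F]_2 := delta_mx 0 0.
Definition e1 : 'rV[F]_2 := delta_mx 0 1.

(* Trilinear extension of [e1,e1,e0] = d e0 and [e1,e1,e1] = c e1.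
   Super-skew-symmetry forces [e1,e0,e1] = - d e0, [e0,e1,e1] = d e0, and the
   remaining brackets, in which e0 occurs at least twice, vanish. *)
Definition bracket11 (d c : F) (x y z : 'rV[F]_2) : 'rV[F]_2 :=
  (d * (x 0 1 * y 0 1 * z 0 0 - x 0 1 * y 0 0 * z 0 1
        + x 0 0 * y 0 1 * z 0 1)) *: e0
  + (c * (x 0 1 * y 0 1 * z 0 1)) *: e1.

Definition twist11 (a b : F) (x : 'rV[F]_2) : 'rV[F]_2 :=
  (a * x 0 0) *: e0 + (b * x 0 1) *: e1.

Definition model11 (d c a b : F) : superTernary F :=
  @SuperTernary F 'rV[F]_2 (fun i => if i then <[e1]>%VS else <[e0]>%VS)
    (bracket11 d c) (twist11 a b).

Definition g1 (a b : F) := model11 0 0 a b.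
Definition g2 (a : F) := model11 0 1 a 0.
Definition g3 := model11 1 0 0 0.
Definition g4 (tau : F) := model11 1 tau 0 0.

Inductive family11 := Family1 | Family2 | Family3 | Family4.

Definition in_family (k : family11) (h : superTernary F) : Prop :=
  match k with
  | Family1 => exists a b : F, h = g1 a b
  | Family2 => exists a : F, h = g2 a
  | Family3 => h = g3
  | Family4 => exists tau : F, tau != 0 /\ h = g4 tau
  end.

End Families.

(* Main.v *)
Require Import Defs.
From HB Require Import structures.
From mathcomp Require Import all_boot all_order all_algebra.
From mathcomp Require Import reals complex.
From mathcomp Require Import ring.
(* Lets [space] denote again the vector space underlying a superalgebra. *)
Import Defs.
Import Order.TTheory GRing.Theory Num.Theory.
Set Implicit Arguments.
Unset Strict Implicit.
Unset Printing Implicit Defensive.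
Local Open Scope ring_scope.

(** In superdimension (1|1), a choice of homogeneous generators f0 (even) and f1
    (odd) turns the whole structure into four scalars: evenness gives
      [f1,f1,f0] = d f0,   [f1,f1,f1] = c f1,   alpha f0 = a f0,   alpha f1 = b f1,
    and super-skew-symmetry determines every other bracket; those in which f0
    occurs twice satisfy v = - v and vanish.  Hence every such g is isomorphic
    to the model with the same constants ([iso_model]).

    The axioms then leave only three equations, b c = b d = a d = 0
    ([constants_constraints]).  The super-Hom-Nambu identity on
    (f1,f1; f1,f1,f1) reads b^2 c^2 = 3 b^2 c^2; on (f0,f1; f1,f1,f1) it reads
    a b c d = 3 b^2 d^2, where the signs coming from the odd entries make the
    three terms add up; and multiplicativity on (f1,f1,f0) reads
    a d = a b^2 d.  Conversely, under these equations a bracket with two twisted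
    arguments is zero, so both sides of the Hom-Nambu identity vanish
    ([model_mult3HomLie]).

    Replacing f1 by t f1 multiplies d and c by t^2 and fixes a and b, while
    rescaling f0 changes nothing.  Over an algebraically closed field one can
    therefore normalise d = 1 if d is nonzero, which forces a = b = 0, and
    otherwise c = 1 if c is nonzero, which forces b = 0: these are the four
    families ([iso_family]).  Conversely an isomorphism changes (d, c) only by
    the square of a nonzero scalar ([iso_model_constants]).  So the family is
    recognised by which of d and c vanish, and in the fourth family, where
    d = 1 on both sides, that square is 1 and tau is an invariant. *)

(** * Homogeneous bases and structure constants *)

Record adapted_basis {F : fieldType} (g : superTernary F) (f0 f1 : space g)
    (d c a b : F) : Prop := AdaptedBasis {
  part_even : part g false = <[f0]>%VS;
  part_odd : part g true = <[f1]>%VS;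
  even_neq0 : f0 != 0;
  odd_neq0 : f1 != 0;
  bracket_110 : bracket f1 f1 f0 = d *: f0;
  bracket_111 : bracket f1 f1 f1 = c *: f1;
  twist_0 : twist f0 = a *: f0;
  twist_1 : twist f1 = b *: f1
}.
Arguments adapted_basis {F} g f0 f1 d c a b.

(** Reduces a consequence [x = y] of one polynomial equation [l = r] to a ring
    identity. *)
Lemma eq_of_subE {V : zmodType} {l r x y : V} : l = r -> x - y = l - r -> x = y.
Proof. by move=> -> /eqP; rewrite subrr subr_eq0 => /eqP. Qed.

Lemma vline_of_dim1 {F : fieldType} {V : vectType F} {U : {vspace V}} :
  \dim U = 1%N -> exists2 v, v != 0 & U = <[v]>%VS.
Proof.
move=> dimU; have U0 : U != 0%VS by rewrite -dimv_eq0 dimU.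
have v0 : vpick U != 0 by rewrite vpick0.
exists (vpick U) => //; apply/esym/eqP.
by rewrite eqEdim -memvE memv_pick dim_vline v0 dimU.
Qed.

Lemma adapted_basis_exists {F : fieldType} {g : superTernary F} :
  mult3HomLieSuperalgebra g -> superdim g = (1%N, 1%N) ->
  exists f0 f1 d c a b, adapted_basis g f0 f1 d c a b.
Proof.
move=> gP [/vline_of_dim1 [f0 f0n0 E0] /vline_of_dim1 [f1 f1n0 E1]].
have m0 : f0 \in part g false by rewrite E0 memv_line.
have m1 : f1 \in part g true by rewrite E1 memv_line.
have := hls_even_bracket gP m1 m1 m0.
rewrite /= E0 => /vlineP [d Ed].
have := hls_even_bracket gP m1 m1 m1.
rewrite /= E1 => /vlineP [c Ec].
have := hls_even_twist gP m0; rewrite E0 => /vlineP [a Ea].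
have := hls_even_twist gP m1; rewrite E1 => /vlineP [b Eb].
by exists f0, f1, d, c, a, b; split.
Qed.

Lemma linear_comb2 {F : fieldType} {U V : lmodType F} {f : U -> V} :
  linear f -> forall p q u v, f (p *: u + q *: v) = p *: f u + q *: f v.
Proof.
move=> fL p q u v.
have fZ k w : f (k *: w) = k *: f w.
  have f0 : f 0 = 0 by have := fL (-1) 0 0; rewrite !scaleN1r addr0 oppr0 addNr.
  by rewrite -[k *: w]addr0 fL f0 addr0.
by rewrite fL fZ.
Qed.

(** Both constants d and c pick up t^2: of the three odd entries of
    [f1,f1,f1], one is absorbed in the value, and [f1,f1,f0] has only two. *)
Lemma rescaled_basis {F : fieldType} {g : superTernary F} {f0 f1 d c a b} (t : F) :
  mult3HomLieSuperalgebra g -> adapted_basis g f0 f1 d c a b -> t != 0 ->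
  adapted_basis g f0 (t *: f1) (t ^+ 2 * d) (t ^+ 2 * c) a b.
Proof.
move=> gP fP t0; have [L1 L2 L3] := hls_trilinear gP.
have Z1 y z k x : bracket (k *: x) y z = k *: bracket x y z :> space g.
  exact: (scalable_linear (L1 y z)).
have Z2 x z k y : bracket x (k *: y) z = k *: bracket x y z :> space g.
  exact: (scalable_linear (L2 x z)).
have Z3 x y k z : bracket x y (k *: z) = k *: bracket x y z :> space g.
  exact: (scalable_linear (L3 x y)).
split; rewrite ?(even_neq0 fP) ?(part_even fP) ?(twist_0 fP) //.
- rewrite (part_odd fP); apply/eqP; rewrite eqEsubv -!memvE.
  rewrite memvZ ?memv_line // andbT.
  by apply/vlineP; exists t^-1; rewrite scalerA mulVf ?scale1r.
- by rewrite scaler_eq0 negb_or t0 (odd_neq0 fP).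
- by rewrite Z1 Z2 (bracket_110 fP) !scalerA expr2.
- by rewrite Z1 Z2 Z3 (bracket_111 fP) !scalerA; congr (_ *: _); ring.
- rewrite (scalable_linear (hls_linear_twist gP)) (twist_1 fP) /=.
  by rewrite !scalerA mulrC.
Qed.

(** * Coordinates on the model space *)

Definition comb {F : fieldType} {V : vectType F} (f0 f1 : V) (v : 'rV[F]_2) : V :=
  v 0 0 *: f0 + v 0 1 *: f1.

Lemma comb_is_linear {F : fieldType} {V : vectType F} (f0 f1 : V) :
  linear (comb f0 f1).
Proof.
by move=> k u v; rewrite /comb !mxE !scalerDl scalerDr !scalerA addrACA.
Qed.

HB.instance Definition _ (F : fieldType) (V : vectType F) (f0 f1 : V) :=
  GRing.isLinear.Build F 'rV[F]_2 V *:%R (comb f0 f1) (comb_is_linear f0 f1).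

Lemma rV2P {F : fieldType} (u v : 'rV[F]_2) :
  u 0 0 = v 0 0 -> u 0 1 = v 0 1 -> u = v.
Proof.
move=> h0 h1; apply/rowP => -[[|[|//]] i].
- by have -> : Ordinal i = 0 by apply: val_inj.
- by have -> : Ordinal i = 1 by apply: val_inj.
Qed.

Lemma bracket11_0 {F : fieldType} (d c : F) x y z :
  bracket11 d c x y z 0 0 =
  d * (x 0 1 * y 0 1 * z 0 0 - x 0 1 * y 0 0 * z 0 1 + x 0 0 * y 0 1 * z 0 1).
Proof. by rewrite !mxE /= !mulr1n mulr0n mulr1 mulr0 addr0. Qed.

Lemma bracket11_1 {F : fieldType} (d c : F) x y z :
  bracket11 d c x y z 0 1 = c * (x 0 1 * y 0 1 * z 0 1).
Proof. by rewrite !mxE /= mulr1 mulr0 add0r. Qed.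

Lemma twist11_0 {F : fieldType} (a b : F) x : twist11 a b x 0 0 = a * x 0 0.
Proof. by rewrite !mxE /= mulr1 mulr0 addr0. Qed.

Lemma twist11_1 {F : fieldType} (a b : F) x : twist11 a b x 0 1 = b * x 0 1.
Proof. by rewrite !mxE /= mulr1 mulr0 add0r. Qed.

Lemma e0_0 {F : fieldType} : e0 F 0 0 = 1. Proof. by rewrite mxE. Qed.
Lemma e0_1 {F : fieldType} : e0 F 0 1 = 0. Proof. by rewrite mxE. Qed.
Lemma e1_0 {F : fieldType} : e1 F 0 0 = 0. Proof. by rewrite mxE. Qed.
Lemma e1_1 {F : fieldType} : e1 F 0 1 = 1. Proof. by rewrite mxE. Qed.

Lemma entryD {F : fieldType} (u v : 'rV[F]_2) i : (u + v) 0 i = u 0 i + v 0 i.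
Proof. by rewrite mxE. Qed.
Lemma entryZ {F : fieldType} (k : F) (v : 'rV[F]_2) i : (k *: v) 0 i = k * v 0 i.
Proof. by rewrite mxE. Qed.
Lemma entryN {F : fieldType} (v : 'rV[F]_2) i : (- v) 0 i = - v 0 i.
Proof. by rewrite mxE. Qed.
Lemma entry0 {F : fieldType} i : (0 : 'rV[F]_2) 0 i = 0.
Proof. by rewrite mxE. Qed.

Definition coordE {F : fieldType} :=
  (@bracket11_0 F, @bracket11_1 F, @twist11_0 F, @twist11_1 F,
   @e0_0 F, @e0_1 F, @e1_0 F, @e1_1 F,
   @entryD F, @entryZ F, @entryN F, @entry0 F).

Lemma rV2_e0e1 {F : fieldType} (v : 'rV[F]_2) :
  v = v 0 0 *: e0 F + v 0 1 *: e1 F.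
Proof.
by apply: rV2P; rewrite !coordE ?mulr1 ?mulr0 ?addr0 ?add0r.
Qed.

(** * Comparison of a superalgebra with its model *)

Section AdaptedCoordinates.
Variables (F : numFieldType) (g : superTernary F) (f0 f1 : space g).
Variables (d c a b : F).
Hypothesis gP : mult3HomLieSuperalgebra g.
Hypothesis fP : adapted_basis g f0 f1 d c a b.

Let m0 : f0 \in part g false. Proof. by rewrite (part_even fP) memv_line. Qed.
Let m1 : f1 \in part g true. Proof. by rewrite (part_odd fP) memv_line. Qed.

(** The super-skew-symmetry rules reduce the eight brackets of basis vectors to
    the two structure constants; characteristic 0 is what kills [f0,f0,z]. *)
Lemma comb_bracket x y z :
  bracket (comb f0 f1 x) (comb f0 f1 y) (comb f0 f1 z)
    = comb f0 f1 (bracket11 d c x y z).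
Proof.
have skew := hls_super_skew gP.
have eqN0 (v : space g) : v = - v -> v = 0.
  move=> /eqP; rewrite -addr_eq0 -mulr2n -scaler_nat scaler_eq0 pnatr_eq0 /=.
  by move/eqP.
have B000 : bracket f0 f0 f0 = 0 :> space g.
  by apply: eqN0; have [+ _] := skew _ _ _ _ _ _ m0 m0 m0; rewrite scale1r.
have B001 : bracket f0 f0 f1 = 0 :> space g.
  by apply: eqN0; have [+ _] := skew _ _ _ _ _ _ m0 m0 m1; rewrite scale1r.
have B010 : bracket f0 f1 f0 = 0 :> space g.
  have [_] := skew _ _ _ _ _ _ m0 m1 m0.
  by rewrite B001 scaler0 oppr0.
have B100 : bracket f1 f0 f0 = 0 :> space g.
  by have [] := skew _ _ _ _ _ _ m1 m0 m0; rewrite B010 scaler0 oppr0.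
have B101 : bracket f1 f0 f1 = - d *: f0 :> space g.
  have [_] := skew _ _ _ _ _ _ m1 m0 m1.
  by rewrite (bracket_110 fP) scale1r scaleNr.
have B011 : bracket f0 f1 f1 = d *: f0 :> space g.
  have [+ _] := skew _ _ _ _ _ _ m0 m1 m1.
  by rewrite B101 scale1r scaleNr opprK.
have [L1 L2 L3] := hls_trilinear gP.
rewrite /comb !coordE (linear_comb2 (L1 _ _)) !(linear_comb2 (L2 _ _)).
rewrite !(linear_comb2 (L3 _ _)) B000 B001 B010 B100 B101 B011.
rewrite (bracket_110 fP) (bracket_111 fP) !scaler0 ?(add0r, addr0, scaler0).
rewrite !scalerDr !scalerA !addrA -!scalerDl.
by congr (_ *: _ + _ *: _); ring.
Qed.

Lemma comb_twist x : twist (comb f0 f1 x) = comb f0 f1 (twist11 a b x).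
Proof.
rewrite /comb !coordE (linear_comb2 (hls_linear_twist gP)).
by rewrite (twist_0 fP) (twist_1 fP) !scalerA !(mulrC _ (x 0 _)).
Qed.

Lemma comb_inj : injective (comb f0 f1).
Proof.
move=> u v /eqP; rewrite -subr_eq0 -linearB /comb => /eqP uv0.
have key p q : p *: f0 + q *: f1 = 0 -> p = 0 /\ q = 0.
  move=> /eqP; rewrite addr_eq0 => /eqP E.
  have [/directv_addP D _] := hls_graded gP.
  have : p *: f0 \in (part g false :&: part g true)%VS.
    by rewrite memv_cap memvZ //= E memvN memvZ.
  rewrite D memv0 => /eqP E0; move: E; rewrite E0 => /esym/eqP; rewrite oppr_eq0.
  move: E0 => /eqP; rewrite !scaler_eq0 (negPf (even_neq0 fP)).
  by rewrite (negPf (odd_neq0 fP)) !orbF => /eqP -> /eqP ->.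
have [] := key _ _ uv0; rewrite !mxE => /eqP + /eqP.
by rewrite !subr_eq0 => /eqP ? /eqP ?; apply: rV2P.
Qed.

Lemma comb_surj x : exists v, x = comb f0 f1 v.
Proof.
have [_ gfull] := hls_graded gP.
have /memv_addP [x0 + [x1 + ->]] : x \in (part g false + part g true)%VS.
  by rewrite gfull memvf.
rewrite (part_even fP) (part_odd fP) => /vlineP [p ->] /vlineP [q ->].
exists (p *: e0 F + q *: e1 F); rewrite linearD !linearZ /= /comb !coordE.
by rewrite !scale0r !scale1r addr0 add0r.
Qed.

Lemma comb_part i v : v \in part (model11 d c a b) i -> comb f0 f1 v \in part g i.
Proof.
by case: i => /vlineP [p ->]; rewrite linearZ memvZ //= /comb !coordE scale0r
  scale1r ?addr0 ?add0r.
Qed.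

(** [comb] is an isomorphism from the model, and its inverse is the required
    map. *)
Lemma iso_model : isomorphic g (model11 d c a b).
Proof.
pose psi : 'Hom('rV[F]_2, space g) := linfun (comb f0 f1).
have psiE v : psi v = comb f0 f1 v by rewrite lfunE.
have ker0 : lker psi == 0%VS by apply/lker0P => u v; rewrite !psiE => /comb_inj.
have psiK v : (psi^-1)%VF (comb f0 f1 v) = v by rewrite -psiE lker0_lfunK.
exists (psi^-1)%VF; split.
- exists psi => [x|v]; last by rewrite psiE psiK.
  by have [v ->] := comb_surj x; rewrite psiK psiE.
- case=> x; rewrite (part_even fP, part_odd fP) => /vlineP [p ->];
    rewrite linearZ memvZ //=.
  + have -> : f1 = comb f0 f1 (e1 F) by rewrite /comb !coordE scale0r scale1r add0r.
    by rewrite psiK memv_line.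
  + have -> : f0 = comb f0 f1 (e0 F) by rewrite /comb !coordE scale0r scale1r addr0.
    by rewrite psiK memv_line.
- move=> x y z; have [u ->] := comb_surj x; have [v ->] := comb_surj y.
  by have [w ->] := comb_surj z; rewrite comb_bracket !psiK.
- by move=> x; have [u ->] := comb_surj x; rewrite comb_twist !psiK.
Qed.

(** The identities are pulled back along [comb], which is injective, and then
    read off in coordinates.  The order matters: b c = 0 kills the left-hand
    side of a b c d = 3 (b d)^2, and b d = 0 the right-hand side of
    a d = (b d) (a b). *)
Lemma constants_constraints : [/\ b * c = 0, b * d = 0 & a * d = 0].
Proof.
have me0 : e0 F \in part (model11 d c a b) false by exact: memv_line.
have me1 : e1 F \in part (model11 d c a b) true by exact: memv_line.
have nambu p1 p2 q1 q2 q3 x1 x2 y1 y2 y3 :=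
  hls_super_hom_nambu gP (p1 := p1) (p2 := p2) (q1 := q1) (q2 := q2) (q3 := q3)
  (x1 := comb f0 f1 x1) (x2 := comb f0 f1 x2) (y1 := comb f0 f1 y1)
  (y2 := comb f0 f1 y2) (y3 := comb f0 f1 y3).
have bc0 : b * c = 0.
  (* Hom-Nambu on (f1,f1; f1,f1,f1), where all signs are +1. *)
  have := nambu _ _ _ _ _ _ _ _ _ _ (comb_part me1) (comb_part me1)
    (comb_part me1) (comb_part me1) (comb_part me1).
  rewrite !comb_twist !comb_bracket -!linearZ -!linearD /= => /comb_inj.
  move=> /(congr1 (fun v : 'rV__ => v 0 1)); rewrite !coordE => E.
  have /eqP : 2%:R * (b * c) ^+ 2 = 0 by apply: (eq_of_subE (esym E)) => /=; ring.
  by rewrite mulf_eq0 pnatr_eq0 expf_eq0 /= => /eqP.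
have bd0 : b * d = 0.
  (* Hom-Nambu on (f0,f1; f1,f1,f1); the second sign is -1. *)
  have := nambu _ _ _ _ _ _ _ _ _ _ (comb_part me0) (comb_part me1)
    (comb_part me1) (comb_part me1) (comb_part me1).
  rewrite !comb_twist !comb_bracket -!linearZ -!linearD /= => /comb_inj.
  move=> /(congr1 (fun v : 'rV__ => v 0 0)); rewrite !coordE => E.
  have /eqP : 3%:R * (b * d) ^+ 2 = (b * c) * (a * d).
    by apply: (eq_of_subE (esym E)) => /=; ring.
  by rewrite bc0 mul0r mulf_eq0 pnatr_eq0 expf_eq0 /= => /eqP.
split=> //.
(* Multiplicativity on (f1,f1,f0). *)
have := hls_multiplicative gP (comb f0 f1 (e1 F)) (comb f0 f1 (e1 F))
  (comb f0 f1 (e0 F)).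
rewrite !comb_twist !comb_bracket comb_twist => /comb_inj.
move=> /(congr1 (fun v : 'rV__ => v 0 0)); rewrite !coordE => E.
have -> : a * d = (b * d) * (a * b) by apply: (eq_of_subE E); ring.
by rewrite bd0 mul0r.
Qed.

(** An even isomorphism sends f0 and f1 to p e0 and s e1 with p and s nonzero.
    Comparing [f1,f1,f0] and [f1,f1,f1] with their images, one factor p,
    respectively s, cancels. *)
Lemma iso_model_constants d' c' a' b' : isomorphic g (model11 d' c' a' b') ->
  exists2 s, s != 0 & d = s ^+ 2 * d' /\ c = s ^+ 2 * c'.
Proof.
case=> phi [/bij_inj phi_inj phi_part phi_bracket _].
have /vlineP [p Ep] := phi_part _ _ m0; have /vlineP [s Es] := phi_part _ _ m1.
have p0 : p != 0.
  apply: contra_neq (even_neq0 fP) => p0.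
  by apply: phi_inj; rewrite Ep p0 scale0r linear0.
have s0 : s != 0.
  apply: contra_neq (odd_neq0 fP) => s0.
  by apply: phi_inj; rewrite Es s0 scale0r linear0.
exists s => //; split.
- have := phi_bracket f1 f1 f0; rewrite (bracket_110 fP) linearZ /= Ep Es.
  move=> /(congr1 (fun v : 'rV__ => v 0 0)); rewrite !coordE => E.
  by apply: (mulIf p0); apply: (eq_of_subE E); ring.
- have := phi_bracket f1 f1 f1; rewrite (bracket_111 fP) linearZ /= Es.
  move=> /(congr1 (fun v : 'rV__ => v 0 1)); rewrite !coordE => E.
  by apply: (mulIf s0); apply: (eq_of_subE E); ring.
Qed.

End AdaptedCoordinates.

(** * The models *)

Lemma model_part {F : fieldType} (d c a b : F) i (v : 'rV[F]_2) :
  v \in part (model11 d c a b) i = (v 0 (if i then 0 else 1) == 0).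
Proof.
case: i; apply/idP/eqP => [/vlineP[p ->]|v0].
- by rewrite !coordE mulr0.
- by rewrite [v]rV2_e0e1 v0 scale0r add0r memvZ ?memv_line.
- by rewrite !coordE mulr0.
- by rewrite [v]rV2_e0e1 v0 scale0r addr0 memvZ ?memv_line.
Qed.

Lemma e0_neq0 {F : fieldType} : e0 F != 0.
Proof. by apply/eqP => /rowP /(_ 0) /eqP; rewrite !coordE oner_eq0. Qed.

Lemma e1_neq0 {F : fieldType} : e1 F != 0.
Proof. by apply/eqP => /rowP /(_ 1) /eqP; rewrite !coordE oner_eq0. Qed.

Lemma model_adapted {F : fieldType} (d c a b : F) :
  adapted_basis (model11 d c a b) (e0 F) (e1 F) d c a b.
Proof.
split; rewrite ?e0_neq0 ?e1_neq0 //=; apply: rV2P; rewrite !coordE; ring.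
Qed.

Lemma model_superdim {F : fieldType} (d c a b : F) :
  superdim (model11 d c a b) = (1%N, 1%N).
Proof. by rewrite /superdim /= !dim_vline e0_neq0 e1_neq0. Qed.

(** The constraints leave three cases, a = b = 0, b = d = 0 and c = d = 0, and
    in each of them a bracket with two twisted arguments vanishes: the twist is
    zero, or its values are even and the bracket needs two odd entries, or the
    bracket is zero.  Every term of the Hom-Nambu identity contains such a
    bracket. *)
Lemma model_mult3HomLie {F : fieldType} (d c a b : F) :
  b * c = 0 -> b * d = 0 -> a * d = 0 ->
  mult3HomLieSuperalgebra (model11 d c a b).
Proof.
move=> /eqP bc0 /eqP bd0 /eqP ad0.
have cases : [\/ a = 0 /\ b = 0, b = 0 /\ d = 0 | c = 0 /\ d = 0].
  move: bc0 bd0 ad0; rewrite !mulf_eq0.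
  move=> /orP[]/eqP-> /orP[]/eqP-> /orP[]/eqP->;
    by [constructor 1 | constructor 2 | constructor 3].
have br12 x y z :
    bracket11 d c (twist11 a b x) (twist11 a b y) z = 0.
  by apply: rV2P; rewrite !coordE; case: cases => -[E1 E2]; rewrite ?E1 ?E2; ring.
have br13 x y z :
    bracket11 d c (twist11 a b x) y (twist11 a b z) = 0.
  by apply: rV2P; rewrite !coordE; case: cases => -[E1 E2]; rewrite ?E1 ?E2; ring.
have br23 x y z :
    bracket11 d c x (twist11 a b y) (twist11 a b z) = 0.
  by apply: rV2P; rewrite !coordE; case: cases => -[E1 E2]; rewrite ?E1 ?E2; ring.
split.
- split.
    apply/directv_addP/eqP; rewrite -subv0; apply/subvP => v.
    rewrite memv_cap !(model_part d c a b) memv0 => /andP[/eqP v1 /eqP v0].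
    by rewrite [v]rV2_e0e1 v0 v1 !scale0r addr0.
  apply/eqP; rewrite eqEsubv subvf /=; apply/subvP => v _.
  by rewrite [v]rV2_e0e1 memv_add ?memvZ ?memv_line.
- by split=> x y k u v; apply: rV2P; rewrite !coordE; ring.
- move=> i j k x y z; rewrite !model_part.
  by case: i j k => [] [] [] /= /eqP x0 /eqP y0 /eqP z0;
    rewrite !coordE ?x0 ?y0 ?z0; apply/eqP; ring.
- by move=> k u v; apply: rV2P; rewrite !coordE; ring.
- by move=> [] x; rewrite !model_part /= coordE => /eqP ->; rewrite mulr0.
- move=> x y z; rewrite [RHS]br12; apply: rV2P; rewrite !coordE;
    by case: cases => -[E1 E2]; rewrite ?E1 ?E2; ring.
- move=> i j k x y z; rewrite !model_part.
  case: i j k => [] [] [] /= /eqP x0 /eqP y0 /eqP z0; split; apply: rV2P;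
  by rewrite !coordE ?x0 ?y0 ?z0; ring.
- move=> p1 p2 q1 q2 q3 x1 x2 y1 y2 y3 _ _ _ _ _ /=.
  by rewrite br12 br13 br23 br12 !scaler0 !addr0.
Qed.

(** * Classification *)

Lemma isomorphic_refl {F : fieldType} (g : superTernary F) : isomorphic g g.
Proof.
exists \1%VF; split=> [|i x|x y z|x]; rewrite ?id_lfunE //.
by exists \1%VF => x; rewrite !id_lfunE.
Qed.

(** The family is decided by the vanishing of d and c alone, which no
    isomorphism changes; this is what makes it unique. *)
Definition family_of {F : fieldType} (d c : F) : family11 :=
  if d == 0 then if c == 0 then Family1 else Family2
  else if c == 0 then Family3 else Family4.

Lemma family_of_scale {F : fieldType} (s d c : F) :
  s != 0 -> family_of (s * d) (s * c) = family_of d c.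
Proof. by move=> s0; rewrite /family_of !mulf_eq0 (negPf s0). Qed.

Lemma in_familyP {F : fieldType} {k : family11} {h : superTernary F} :
  in_family k h -> exists d c a b, h = model11 d c a b /\
    [/\ family_of d c = k, b * c = 0, b * d = 0 & a * d = 0].
Proof.
rewrite /family_of; case: k => /=.
- by case=> a [b ->]; exists 0, 0, a, b; rewrite !mulr0 eqxx.
- by case=> a ->; exists 0, 1, a, 0; rewrite !mulr0 mul0r eqxx oner_eq0.
- by move=> ->; exists 1, 0, 0, 0; rewrite !mul0r eqxx oner_eq0.
- case=> t [/negPf t0 ->]; exists 1, t, 0, 0.
  by rewrite !mul0r oner_eq0 t0.
Qed.

(** The square root needed to rescale d or c to 1 is the only use of algebraic
    closedness. *)
Lemma iso_family {F : numClosedFieldType} {g : superTernary F} {f0 f1 d c a b} :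
  mult3HomLieSuperalgebra g -> adapted_basis g f0 f1 d c a b ->
  exists h, in_family (family_of d c) h /\ isomorphic g h.
Proof.
move=> gP fP; have [bc0 bd0 ad0] := constants_constraints gP fP.
have scale t : t != 0 -> isomorphic g (model11 (t ^+ 2 * d) (t ^+ 2 * c) a b).
  by move=> t0; apply: (iso_model gP (rescaled_basis gP fP t0)).
have norm1 e : e != 0 -> exists2 t : F, t != 0 & t ^+ 2 = e^-1.
  by move=> e0; exists (sqrtC e^-1); rewrite ?sqrtCK ?sqrtC_eq0 ?invr_eq0.
rewrite /family_of; have [d0|d0] := eqVneq d 0.
  have [c0|c0] := eqVneq c 0.
    exists (g1 a b); split; first by exists a, b.
    by have := iso_model gP fP; rewrite d0 c0.
  exists (g2 a); split; first by exists a.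
  have [t t0 Et] := norm1 c c0; have := scale t t0.
  have /eqP : b * c = 0 := bc0; rewrite mulf_eq0 (negPf c0) orbF => /eqP ->.
  by rewrite Et mulVf // d0 mulr0.
have [t t0 Et] := norm1 d d0; have := scale t t0.
move/eqP: bd0; rewrite mulf_eq0 (negPf d0) orbF => /eqP ->.
move/eqP: ad0; rewrite mulf_eq0 (negPf d0) orbF => /eqP ->.
rewrite Et mulVf //; have [-> | c0] := eqVneq c 0.
  by rewrite mulr0 => iso; exists (g3 F).
move=> iso; exists (g4 (d^-1 * c)); split=> //.
by exists (d^-1 * c); rewrite mulf_neq0 ?invr_eq0.
Qed.

Theorem theorem4p11 (R : realType) :
  [/\ forall (k : family11) (h : superTernary R[i]), in_family k h ->
        mult3HomLieSuperalgebra h /\ superdim h = (1%N, 1%N),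
      forall g : superTernary R[i],
        mult3HomLieSuperalgebra g -> superdim g = (1%N, 1%N) ->
        exists! k : family11,
          exists h : superTernary R[i], in_family k h /\ isomorphic g h
    & forall tau tau' : R[i], tau != 0 -> tau' != 0 ->
        (isomorphic (g4 tau) (g4 tau') <-> tau = tau')].
Proof.
split=> [k h /in_familyP [d [c [a [b [-> [_ bc0 bd0 ad0]]]]]]
  | g gP dimg | t t' t0 t'0].
- by split; [exact: model_mult3HomLie | exact: model_superdim].
- have [f0 [f1 [d [c [a [b fP]]]]]] := adapted_basis_exists gP dimg.
  exists (family_of d c); split; first exact: iso_family gP fP.
  move=> k [h [/in_familyP [d' [c' [a' [b' [-> [<- _ _ _]]]]]] iso]].
  have [s s0 [-> ->]] := iso_model_constants fP iso.
  by rewrite family_of_scale ?expf_neq0.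
- split=> [iso|->]; last exact: isomorphic_refl.
  have [s _ [Es ->]] := iso_model_constants (model_adapted 1 t 0 0) iso.
  by rewrite -[s ^+ 2]mulr1 -Es mul1r.
Qed.
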